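(* Let $G=(V,E)$ be an undirected graph with $V=[n]$ and let $\mathcal{Z}\subseteq\mathbb{R}^E$ be a convex and compact uncertainty set of edge weights. Consider $$(\mathrm{S})\qquad sdp(G,\mathcal{Z})=\max_{Y\in\mathcal{S}^n_{\succeq 0}}\ \min_{w\in\mathcal{Z}}\ \Bigl\langle\tfrac14L(w),Y\Bigr\rangle\quad\text{s.t.}\quad \langle E_{ii},Y\rangle=1\quad\text{for all } i\in[n].$$ Let $Y^*$ Pareto dominate $\bar Y$ for $(\mathrm{S})$, and let $x^*$ and $\bar x$ denote the corresponding cuts derived from $Y^*$ and $\bar Y$, respectively, via the Goemans-Williamson Algorithm. For a feasible $Y$ of $(\mathrm{S})$ denote $$sdp(G,w,Y)=\frac14\sum_{\{i,j\}\in E}w_{ij}(1-y_i^\top y_j),$$ where $y_1,\dots,y_n$ are the columns of the Cholesky decomposition of $Y$ (so $y_i^\top y_j=Y_{ij}$). Then, for every $w\in\mathcal{Z}$, $$mc(G,w)\ \ge\ 0.878\ldots\, sdp(G,w,Y^* )\ \ge\ 0.878\ldots\, sdp(G,w,\bar Y),$$ where $0.878\ldots$ is the Goemans-Williamson constant, and there exists a $w\in\mathcal{Z}$ for which the last inequality holds strictly.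
   Context: $[n]=\{1,\dots,n\}$. $\mathcal{S}^n$ is the space of real symmetric $n\times n$ matrices with the Frobenius inner product $\langle\cdot,\cdot\rangle$, and $\mathcal{S}^n_{\succeq 0}$ is its subset of positive semidefinite matrices. With $e_i$ the $i$-th unit vector of $\mathbb{R}^n$, $E_{ij}=\frac12(e_ie_j^\top+e_je_i^\top)$, $E'_{ij}=E_{ii}+E_{jj}-2E_{ij}$, and $L(w)=\sum_{\{i,j\}\in E}w_{ij}E'_{ij}$ is the weighted Laplacian. For $w\in\mathbb{R}^E$, $mc(G,w)=\max_{V'\subseteq V}\sum_{e\in\delta(V')}w_e=\max_{x\in\{-1,1\}^V}\frac14x^\top L(w)x$ is the maximum weight of a cut, where $\delta(V')=\{e\in E:|e\cap V'|=1\}$. The uncertainty set is assumed not to be a singleton. Pareto dominance for $(\mathrm{S})$: for a robustly optimal (i.e. optimal for $(\mathrm{S})$) solution $\bar Y$, a feasible $Y^*$ of $(\mathrm{S})$ Pareto dominates $\bar Y$ if $\langle \frac14L(w),Y^*\rangle\ge\langle \frac14L(w),\bar Y\rangle$ for all $w\in\mathcal{Z}$ and $\langle \frac14L(\bar w),Y^*\rangle>\langle \frac14L(\bar w),\bar Y\rangle$ for at least one $\bar w\in\mathcal{Z}$. Goemans-Williamson Algorithm: given a feasible $Y$ of $(\mathrm{S})$ with Cholesky columns $y_1,\dots,y_n$, draw $r$ from the rotationally invariant probability distribution on the unit sphere $S^{n-1}$ and output the cut $x\in\{-1,1\}^V$ with $x_k=\mathrm{sign}(y_k^\top r)$. The Goemans-Williamson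 constant is $\min_{0<\theta\le\pi}\frac{2}{\pi}\frac{\theta}{1-\cos\theta}=0.878\ldots$.
   Formalization: The first inequality, mc(G,w) ≥ 0.878… sdp(G,w,Y* ), is false for weights of mixed sign, so it is stated only for those w in Z with all edge weights nonnegative; the second inequality and its strictness are stated for all Z. *)

(* Defs.v *)
From HB Require Import structures.
From mathcomp Require Import all_boot all_order all_algebra.
From mathcomp Require Import all_classical all_reals all_analysis.

Set Implicit Arguments.
Unset Strict Implicit.
Unset Printing Implicit Defensive.

Import Order.TTheory GRing.Theory Num.Theory.
Import numFieldNormedType.Exports.

Local Open Scope classical_set_scope.
Local Open Scope ring_scope.

(* An undirected graph on the vertex set 'I_n is a symmetric irreflexive
   relation g; the edge {i, j} is represented by the pair (i, j) with i < j, so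
   that each edge occurs exactly once and edge g -> R is R^E. *)
Definition edge (n : nat) (g : rel 'I_n) : finType :=
  {p : 'I_n * 'I_n | g p.1 p.2 && (p.1 < p.2)%N}.

Definition end1 (n : nat) (g : rel 'I_n) (e : edge g) : 'I_n := (val e).1.
Definition end2 (n : nat) (g : rel 'I_n) (e : edge g) : 'I_n := (val e).2.

Definition cut_edges (n : nat) (g : rel 'I_n) (V' : {set 'I_n}) :
    {set edge g} :=
  [set e | #|[set end1 e; end2 e] :&: V'| == 1%N]%SET.

Definition cut_weight (R : realType) (n : nat) (g : rel 'I_n)
    (w : edge g -> R) (V' : {set 'I_n}) : R :=
  \sum_(e in cut_edges g V') w e.

(* A maximum over a nonempty finite family: the default value of the iterated
   maximum is the weight of the cut given by the empty set. *)
Definition mc (R : realType) (n : nat) (g : rel 'I_n) (w : edge g -> R) : R :=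
  \big[Num.max/cut_weight w finset.set0]_(V' : {set 'I_n}) cut_weight w V'.

(* delta_mx i j is e_i e_j^T. *)
Definition Emx (R : realType) (n : nat) (i j : 'I_n) : 'M[R]_n :=
  2^-1 *: (delta_mx i j + delta_mx j i).

Definition Emx' (R : realType) (n : nat) (i j : 'I_n) : 'M[R]_n :=
  Emx R i i + Emx R j j - 2 *: Emx R i j.

Definition laplacian (R : realType) (n : nat) (g : rel 'I_n)
    (w : edge g -> R) : 'M[R]_n :=
  \sum_(e : edge g) w e *: Emx' R (end1 e) (end2 e).

Definition frobenius (R : realType) (n : nat) (A B : 'M[R]_n) : R :=
  \tr (A^T *m B).

Definition psd (R : realType) (n : nat) (Y : 'M[R]_n) : Prop :=
  Y^T = Y /\ forall x : 'cV[R]_n, 0 <= (x^T *m Y *m x) 0 0.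

Definition feasible (R : realType) (n : nat) (Y : 'M[R]_n) : Prop :=
  psd Y /\ forall i : 'I_n, frobenius (Emx R i i) Y = 1.

Definition objective (R : realType) (n : nat) (g : rel 'I_n)
    (w : edge g -> R) (Y : 'M[R]_n) : R :=
  frobenius (4^-1 *: laplacian w) Y.

(* The infimum is a minimum when Z is nonempty and compact. *)
Definition worst_case (R : realType) (n : nat) (g : rel 'I_n)
    (Z : set (edge g -> R)) (Y : 'M[R]_n) : R :=
  inf [set objective w Y | w in Z].

Definition robustly_optimal (R : realType) (n : nat) (g : rel 'I_n)
    (Z : set (edge g -> R)) (Y : 'M[R]_n) : Prop :=
  feasible Y /\
  forall Y' : 'M[R]_n, feasible Y' -> worst_case Z Y' <= worst_case Z Y.

Definition pareto_dominates (R : realType) (n : nat) (g : rel 'I_n)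
    (Z : set (edge g -> R)) (Ystar Ybar : 'M[R]_n) : Prop :=
  [/\ robustly_optimal Z Ybar,
      feasible Ystar,
      forall w, Z w -> objective w Ybar <= objective w Ystar &
      exists2 w, Z w & objective w Ybar < objective w Ystar].

(* Y = C^T C with C upper triangular; the vectors y_i are the columns of C. A
   singular Y may have several such factors. *)
Definition cholesky (R : realType) (n : nat) (Y C : 'M[R]_n) : Prop :=
  [/\ is_trig_mx C^T, forall i, 0 <= C i i & Y = C^T *m C].

(* The sdp(G, w, Y) of a feasible Y, as a function of a Cholesky factor C of Y.
   The prefactor is 1/4 and each edge is counted once, so this is one half of
   objective w Y. *)
Definition sdp_value (R : realType) (n : nat) (g : rel 'I_n)
    (w : edge g -> R) (C : 'M[R]_n) : R :=
  4^-1 * \sum_(e : edge g)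
            w e * (1 - ((col (end1 e) C)^T *m col (end2 e) C) 0 0).

(* The Goemans-Williamson constant 0.878...; the infimum is attained. *)
Definition gw_const (R : realType) : R :=
  inf [set 2 / pi * (t / (1 - cos t)) | t in `]0, pi] : set R].

(* Main.v *)
Require Import Defs.
From HB Require Import structures.
From mathcomp Require Import all_boot all_order all_algebra.
From mathcomp Require Import all_classical all_reals all_analysis.
From mathcomp Require Import ring lra.
Import Order.TTheory GRing.Theory Num.Theory.
Import numFieldNormedType.Exports.
Local Open Scope classical_set_scope.
Local Open Scope ring_scope.

(** The prefactor 1/4 makes [sdp_value w C] one half of the objective
    [<L(w)/4, Y>] at a feasible [Y] ([objective_sdp_value]), so Pareto dominance
    of [Ystar] over [Ybar] is literally an inequality between their
    [sdp_value]s, strict at some [w] in [Z]; multiplying by the constant keeps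
    it, and keeps it strict, because the constant is positive
    ([gw_const_gt0]).

    The same prefactor lets a random cut that ignores [Y] already give the bound
    on [mc w]: a uniformly random vertex set cuts every edge with
    probability 1/2, so [mc w >= (sum of w) / 2] ([mc_ge_half]).  In the other
    direction [1 - y_i^T y_j <= 2] for unit vectors, so for nonnegative weights
    [0 <= sdp_value w C <= (sum of w) / 2] ([sdp_value_ge0], [sdp_value_le_half]).
    Since [gw_const <= 1] ([gw_const_le1]), the chain
    [gw_const * sdp_value w C <= sdp_value w C <= mc w] follows. *)

Section FrobeniusProduct.
Context {R : realType} {n : nat}.
Implicit Types A B Y : 'M[R]_n.

Lemma frobeniusDl A B Y : frobenius (A + B) Y = frobenius A Y + frobenius B Y.
Proof. by rewrite /frobenius linearD mulmxDl mxtraceD. Qed.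

Lemma frobeniusZl (a : R) A Y : frobenius (a *: A) Y = a * frobenius A Y.
Proof. by rewrite /frobenius linearZ -scalemxAl mxtraceZ. Qed.

Lemma frobenius_suml (I : finType) (F : I -> 'M[R]_n) Y :
  frobenius (\sum_i F i) Y = \sum_i frobenius (F i) Y.
Proof. by rewrite /frobenius raddf_sum mulmx_suml raddf_sum. Qed.

Lemma frobenius_delta (i j : 'I_n) Y : frobenius (delta_mx i j) Y = Y i j.
Proof.
rewrite /frobenius trmx_delta /mxtrace (bigD1 j) //= big1 => [|k kj].
  rewrite mxE (bigD1 i) //= big1 ?mxE ?eqxx ?mul1r ?addr0 // => l li.
  by rewrite mxE (negPf li) andbF mul0r.
by rewrite mxE big1 // => l _; rewrite mxE (negPf kj) mul0r.
Qed.

Lemma frobenius_Emx (i j : 'I_n) Y :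
  frobenius (Emx R i j) Y = 2^-1 * (Y i j + Y j i).
Proof. by rewrite frobeniusZl frobeniusDl !frobenius_delta. Qed.

Lemma feasible_diag Y (i : 'I_n) : feasible Y -> Y i i = 1.
Proof.
by case=> _ /(_ i); rewrite frobenius_Emx; lra.
Qed.

End FrobeniusProduct.

Section FeasibleValue.
Context {R : realType} {n : nat} {g : rel 'I_n}.
Variables (Y C : 'M[R]_n).
Hypotheses (Yfeas : feasible Y) (YC : cholesky Y C).
Implicit Types w : edge g -> R.

Lemma cholesky_dot (i j : 'I_n) : ((col i C)^T *m col j C) 0 0 = Y i j.
Proof.
by case: YC => _ _ ->; rewrite !mxE; apply: eq_bigr => k _; rewrite !mxE.
Qed.

Lemma objective_sdp_value w : objective w Y = 2 * sdp_value w C.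
Proof.
rewrite /objective /sdp_value frobeniusZl frobenius_suml [RHS]mulrCA.
congr (_ * _); rewrite mulr_sumr; apply: eq_bigr => e _.
rewrite cholesky_dot frobeniusZl /Emx' -scaleNr 2!frobeniusDl.
rewrite [frobenius (- 2 *: _) _]frobeniusZl !frobenius_Emx !feasible_diag //.
have [[/matrixP/(_ (end1 e) (end2 e)) + _] _] := Yfeas.
by rewrite mxE => ->; field.
Qed.

(** Expanding [0 <= |y_i + s y_j|^2] with unit [y_i], [y_j] and [s = 1, -1]
    gives the two bounds. *)
Lemma feasible_entry_bounds (i j : 'I_n) : -1 <= Y i j <= 1.
Proof.
have entry (k l : 'I_n) : Y k l = \sum_m C m k * C m l.
  by case: YC => _ _ ->; rewrite mxE; apply: eq_bigr => m _; rewrite mxE.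
have sq_ge0 (s : R) : 0 <= Y i i + (s *+ 2) * Y i j + s ^+ 2 * Y j j.
  rewrite !entry !mulr_sumr -!big_split /=; apply: sumr_ge0 => m _.
  have := sqr_ge0 (C m i + s * C m j); congr (0 <= _); ring.
have := sq_ge0 1; have := sq_ge0 (-1); rewrite !feasible_diag // => h1 h2.
by apply/andP; split; nra.
Qed.

Lemma sdp_value_ge0 w : (forall e, 0 <= w e) -> 0 <= sdp_value w C.
Proof.
move=> w0; apply: mulr_ge0; rewrite ?invr_ge0 //; apply: sumr_ge0 => e _.
rewrite cholesky_dot mulr_ge0 // subr_ge0.
by have /andP[] := feasible_entry_bounds (end1 e) (end2 e).
Qed.

Lemma sdp_value_le_half w :
  (forall e, 0 <= w e) -> sdp_value w C <= 2^-1 * \sum_e w e.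
Proof.
move=> w0; rewrite /sdp_value !mulr_sumr; apply: ler_sum => e _.
rewrite cholesky_dot; have := w0 e.
have /andP[] := feasible_entry_bounds (end1 e) (end2 e); nra.
Qed.

End FeasibleValue.

Section UniformCut.
Context {R : realType} {n : nat} {g : rel 'I_n}.
Implicit Types (w : edge g -> R) (e : edge g) (V : {set 'I_n}).

Lemma end1_neq_end2 e : end1 e != end2 e.
Proof.
by have /andP[_] := valP e; apply: contraTneq; rewrite /end1 /end2 => ->;
  rewrite ltnn.
Qed.

Lemma in_cut_edges e V :
  (e \in cut_edges g V) = (end1 e \in V) (+) (end2 e \in V).
Proof.
rewrite inE (cardsD1 (end1 e)) (cardsD1 (end2 e)) !inE !eqxx orbT /=.
rewrite (eq_sym (end2 e)) (negPf (end1_neq_end2 e)) /=.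
rewrite (_ : _ :\ _ = finset.set0) ?cards0; last first.
  by apply/setP => k; rewrite !inE; do 2 case: (k == _).
by case: (end1 e \in V) (end2 e \in V) => [] [].
Qed.

Definition toggle (i : 'I_n) V : {set 'I_n} :=
  [set k | (k \in V) (+) (k == i)]%SET.

Lemma toggleK (i : 'I_n) : involutive (toggle i).
Proof. by move=> V; apply/setP => k; rewrite !inE -addbA addbb addbF. Qed.

(** Toggling one end of [e] is an involution on the vertex sets that exchanges
    those that cut [e] with those that do not. *)
Lemma sum_cut_indicator e :
  \sum_V ((e \in cut_edges g V)%:R : R) = 2^-1 * #|{set 'I_n}|%:R.
Proof.
have tog : \sum_V ((e \in cut_edges g V)%:R : R)
         = \sum_V ((e \notin cut_edges g V)%:R : R).
  rewrite (reindex_inj (inv_inj (toggleK (end1 e)))); apply: eq_bigr => V _.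
  rewrite !in_cut_edges !inE eqxx (eq_sym (end2 e)).
  rewrite (negPf (end1_neq_end2 e)).
  by case: (end1 e \in V) (end2 e \in V) => [] [].
apply: (mulfI (x := 2)); rewrite ?pnatr_eq0 // mulVKf ?pnatr_eq0 //.
rewrite mulr_natl mulr2n [X in _ + X]tog -big_split /=.
rewrite (eq_bigr (fun=> 1)) ?sumr_const // => V _.
by case: (e \in _); rewrite ?addr0 ?add0r.
Qed.

(** A maximum is at least the average over all vertex sets. *)
Lemma mc_ge_half w : 2^-1 * \sum_e w e <= mc w.
Proof.
have N0 : 0 < #|{set 'I_n}|%:R :> R.
  by rewrite ltr0n; apply/card_gt0P; exists finset.set0.
rewrite -(ler_pM2r N0) mulrAC mulr_sumr.
have -> : \sum_e 2^-1 * #|{set 'I_n}|%:R * w e = \sum_V cut_weight w V.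
  under [RHS]eq_bigr do rewrite /cut_weight big_mkcond.
  rewrite exchange_big; apply: eq_bigr => e _.
  rewrite -(sum_cut_indicator e) mulr_suml; apply: eq_bigr => V _.
  by case: ifP; rewrite ?mul1r ?mul0r.
rewrite mulr_natr -sumr_const; apply: ler_sum => V _; exact: le_bigmax.
Qed.

End UniformCut.

Section GoemansWilliamsonConstant.
Context {R : realType}.
Implicit Types t : R.

Lemma one_sub_cos_le t : 0 <= t -> 1 - cos t <= t.
Proof.
move=> t0; have [|c _] := @MVT_segment R cos (fun x => - sin x) 0 t t0.
  by apply: continuous_subspaceT => x; exact: continuous_cos.
by rewrite cos0 subr0; have := sin_le1 c; nra.
Qed.

Let ratios : set R := [set 2 / pi * (t / (1 - cos t)) | t in `]0, pi]].

(** It is this bound, a consequence of [1 - cos t <= t], that makes the infimum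
    of the ratios positive. *)
Lemma gw_ratios_lbound : lbound ratios (2 / pi).
Proof.
move=> _ [t /= /[!in_itv]/= /andP[t0 tpi] <-].
have cos_lt1 : cos t < 1.
  by rewrite -cos0 ltr_cos ?in_itv //= ?lexx ?pi_ge0 ?tpi ?ltW.
rewrite ler_peMr ?divr_ge0 ?pi_ge0 //.
by rewrite ler_pdivlMr ?subr_gt0 // mul1r one_sub_cos_le ?ltW.
Qed.

Lemma gw_ratio_pihalf : ratios 1.
Proof.
have pi0 := pi_gt0 R.
exists (pi / 2); first by rewrite /= in_itv /=; apply/andP; split; lra.
by rewrite cos_pihalf subr0 divr1 mulrA divfK ?gt_eqF // divff ?pnatr_eq0.
Qed.

Lemma gw_const_gt0 : 0 < gw_const R.
Proof.
apply: (@lt_le_trans _ _ (2 / pi)); first by rewrite divr_gt0 ?pi_gt0.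
by apply: lb_le_inf gw_ratios_lbound; exists 1; exact: gw_ratio_pihalf.
Qed.

Lemma gw_const_le1 : gw_const R <= 1.
Proof.
by apply: ge_inf gw_ratio_pihalf; exists (2 / pi); exact: gw_ratios_lbound.
Qed.

End GoemansWilliamsonConstant.

Theorem proposition4 (R : realType) (n : nat) (g : rel 'I_n)
    (g_sym : symmetric g) (g_irr : irreflexive g)
    (Z : set (edge g -> R))
    (Z_convex : convex_set Z)
    (Z_compact : compact (Z : set {ptws edge g -> R}))
    (Z_not_singleton : ~ exists w, Z = [set w])
    (Ystar Ybar : 'M[R]_n)
    (Y_dom : pareto_dominates Z Ystar Ybar)
    (Cstar Cbar : 'M[R]_n)
    (Cstar_chol : cholesky Ystar Cstar) (Cbar_chol : cholesky Ybar Cbar) :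
  (forall w, Z w ->
     ((forall e, 0 <= w e) -> gw_const R * sdp_value w Cstar <= mc w) /\
     gw_const R * sdp_value w Cbar <= gw_const R * sdp_value w Cstar) /\
  (exists2 w, Z w &
     gw_const R * sdp_value w Cbar < gw_const R * sdp_value w Cstar).
Proof.
have [[Ybar_feas _] Ystar_feas dom [w0 Zw0 w0_lt]] := Y_dom.
have gw0 := @gw_const_gt0 R.
have obj_star := objective_sdp_value _ _ Ystar_feas Cstar_chol.
have obj_bar := objective_sdp_value _ _ Ybar_feas Cbar_chol.
split=> [w Zw|]; last first.
  exists w0 => //; rewrite ltr_pM2l // -(ltr_pM2l (x := 2)) //.
  by rewrite -obj_star -obj_bar.
split=> [w_ge0|]; last first.
  rewrite ler_pM2l // -(ler_pM2l (x := 2)) // -obj_star -obj_bar.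
  exact: dom.
apply: (le_trans _ (mc_ge_half w)).
apply: (le_trans _ (sdp_value_le_half _ _ Ystar_feas Cstar_chol _ w_ge0)).
by rewrite ler_piMl ?gw_const_le1 // (sdp_value_ge0 _ _ Ystar_feas).
Qed.
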